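(* For all integers $n\ge 0$ and $k \geq 1$ put $T_n=\tau(n+1)$ and $S_k=-24\,\sigma(k)$. Then for every integer $n\ge 1$: (i) $n!\,T_n=|J_n(\overline{S})|$; (ii) $S_n=(-1)^{n-1}|H_n(\overline{T})|$; (iii) $-24\,\sigma(n)=(-1)^{n-1}|H_n(\overline{T})|$; (iv) $T_n=\sum_{|\lambda|=n} z_\lambda^{-1}S_\lambda$, the sum running over all partitions $\lambda$ of $n$.
   Context: $\tau$ is Ramanujan's tau function, defined by $\sum_{n\ge1}\tau(n)q^n=q\prod_{m\ge1}(1-q^m)^{24}$, and $\sigma(n)=\sum_{d\mid n}d$. $|M|$ denotes the determinant of a square matrix $M$. For a sequence $\overline{j}=(j_1,j_2,\dots)$, $J_n(\overline{j})$ is the $n\times n$ matrix whose $(i,k)$ entry is $j_{i-k+1}$ for $1\le k\le i\le n$, is $-i$ for $k=i+1$, and is $0$ for $k>i+1$. For a sequence $\overline{h}=(h_0,h_1,h_2,\dots)$ with $h_0=1$, $H_n(\overline{h})$ is the $n\times n$ matrix whose first column has entries $i\,h_i$ ($1\le i\le n$), whose $(i,k)$ entry is $h_{i-k+1}$ for $2\le k\le i$, is $1$ for $k=i+1$, and is $0$ for $k>i+1$. A partition $\lambda$ is a non-increasing sequence $(\lambda_1,\lambda_2,\dots)$ of non-negative integers with finitely many non-zero terms; $|\lambda|=\sum_i\lambda_i$; $m_k(\lambda)$ is the number of parts of $\lambda$ equal to $k$; $z_\lambda=\prod_{k\ge1}k^{m_k(\lambda)}m_k(\lambda)!$; and $S_\lambda=\prod_i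 S_{\lambda_i}$, the product being over the positive parts of $\lambda$. *)

(* Defs.v *)
From HB Require Import structures.
From mathcomp Require Import all_boot all_order all_algebra.
Set Implicit Arguments.
Unset Strict Implicit.
Unset Printing Implicit Defensive.
Import GRing.Theory.
Local Open Scope ring_scope.

(* The coefficient of q^n in q * \prod_(m >= 1) (1 - q^m)^24. The factors with
   m > n do not affect it, so the product may be cut off anywhere from n on:
   see tau_trunc. *)
Definition tau (n : nat) : int :=
  ('X * \prod_(1 <= m < n.+1) (1 - 'X^m) ^+ 24 : {poly int})`_n.

Lemma coef_mul_1subXn (p : {poly int}) (k m n : nat) :
  (n < m)%N -> (p * (1 - 'X^m) ^+ k)`_n = p`_n.
Proof.
move=> lt_nm; elim: k => [|k IHk]; first by rewrite expr0 mulr1.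
by rewrite exprSr mulrA mulrBr mulr1 coefB coefMXn lt_nm subr0.
Qed.

Lemma tau_trunc (n N : nat) : (n <= N)%N ->
  ('X * \prod_(1 <= m < N.+1) (1 - 'X^m) ^+ 24 : {poly int})`_n = tau n.
Proof.
elim: N => [|N IHN]; first by rewrite leqn0 => /eqP->.
rewrite leq_eqVlt => /predU1P[-> // | le_nN].
by rewrite big_nat_recr //= mulrA coef_mul_1subXn // IHN.
Qed.

Lemma tau1 : tau 1 = 1.
Proof.
rewrite /tau big_nat1 coefXM /=.
by rewrite -[_ ^+ _]mul1r -horner_coef0 !hornerE.
Qed.

Definition sigma (n : nat) : nat := (\sum_(d <- divisors n) d)%N.

(* Rows and columns are numbered from 0, i.e. the entry (i, k) below is the
   entry (i + 1, k + 1) of the matrix numbered from 1. The value j 0 is not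
   used. *)
Definition Jmx (R : comNzRingType) (n : nat) (j : nat -> R) : 'M[R]_n :=
  \matrix_(i, k)
    if (k <= i)%N then j (i - k).+1
    else if k == i.+1 :> nat then - (i.+1)%:R
    else 0.

(* Same numbering as Jmx. The 1 above the diagonal is h_0. *)
Definition Hmx (R : comNzRingType) (n : nat) (h : nat -> R) : 'M[R]_n :=
  \matrix_(i, k)
    if k == 0%N :> nat then (i.+1)%:R * h i.+1
    else if (k <= i)%N then h (i - k).+1
    else if k == i.+1 :> nat then 1
    else 0.

(* A partition is represented by the sequence of its non-zero terms. *)
Definition is_partition_of (n : nat) (l : seq nat) : bool :=
  [&& sorted geq l, 0%N \notin l & sumn l == n].

Record partition_of (n : nat) : Type := PartitionOf {
  parts :> seq nat;
  partsP : is_partition_of n parts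
}.

HB.instance Definition _ (n : nat) := [isSub for @parts n].
HB.instance Definition _ (n : nat) := [Countable of partition_of n by <:].

Lemma size_leq_sumn (l : seq nat) : 0%N \notin l -> (size l <= sumn l)%N.
Proof.
elim: l => //= x l IHl; rewrite inE negb_or eq_sym -lt0n => /andP[x_gt0 /IHl].
by rewrite -addn1 addnC; apply: leq_add.
Qed.

Lemma mem_leq_sumn (l : seq nat) (k : nat) : k \in l -> (k <= sumn l)%N.
Proof.
elim: l => //= x l IHl; rewrite inE => /predU1P[-> | /IHl le_k].
  exact: leq_addr.
exact: leq_trans le_k (leq_addl _ _).
Qed.

Definition partition_code n (l : partition_of n) : n.-bseq 'I_n.+1 :=
  insub_bseq n (map inord l).

Definition partition_decode n (s : n.-bseq 'I_n.+1) : option (partition_of n) :=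
  insub (map val s).

Lemma partition_codeK n : pcancel (@partition_code n) (@partition_decode n).
Proof.
move=> l; have /and3P[_ l_gt0 /eqP def_n] := partsP l.
rewrite /partition_code /partition_decode /insub_bseq insubdK; last first.
  by rewrite unfold_in size_map -[leqRHS]def_n size_leq_sumn.
rewrite -map_comp (_ : map _ _ = parts l); first exact: valK.
rewrite -[RHS]map_id; apply/eq_in_map => k k_l /=.
by rewrite inordK // ltnS -[leqRHS]def_n mem_leq_sumn.
Qed.

HB.instance Definition _ (n : nat) : isFinite (partition_of n) :=
  PCanIsFinite (@partition_codeK n).

(* The parts of l are at most sumn l, so every k left out of the product
   contributes a factor 1. *)
Definition zpart (l : seq nat) : nat :=
  (\prod_(1 <= k < (sumn l).+1) (k ^ count_mem k l * (count_mem k l)`!))%N.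

Definition spart (R : comNzRingType) (S : nat -> R) (l : seq nat) : R :=
  \prod_(k <- l) S k.

(* Main.v *)
Require Import Defs.
From mathcomp Require Import all_boot all_order all_algebra.
Set Implicit Arguments.
Unset Strict Implicit.
Unset Printing Implicit Defensive.
Import Order.TTheory GRing.Theory Num.Theory.
Local Open Scope ring_scope.

(* Everything follows from Newton's recurrence
     n T_n = \sum_(1 <= k <= n) S_k T_(n - k),
   obtained by comparing coefficients in the logarithmic derivative of the
   product \prod_m (1 - q^m)^24, where m q^m / (1 - q^m), summed over m, is the
   generating series of sigma.  Seen as a linear system in the T_k, respectively
   in the S_k, the recurrence says that the Hessenberg matrix J_n, respectively
   H_n, sends an explicit vector with first entry 1 to a multiple of the last
   unit vector, which yields its determinant.  Finally the sum over partitions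
   satisfies the same recurrence, because removing a part k from a partition
   with m_k parts k divides z by k m_k and S by S_k. *)

(** * Newton's recurrence for tau by logarithmic differentiation *)

(** At n = 0 this reads 0 = 0, so [h 0] stays free and has to be normalised separately. *)
Definition newton_rec (R : nzRingType) (p h : nat -> R) : Prop :=
  forall n, n%:R * h n = \sum_(k < n) p k.+1 * h (n - k.+1)%N.

(** Congruence modulo X^(N+1): polynomials stand in for power series. *)
Definition eq_upto (R : nzRingType) (N : nat) (p q : {poly R}) : Prop :=
  forall i, (i <= N)%N -> p`_i = q`_i.

Lemma eq_upto_mulr (R : comNzRingType) N (p q r : {poly R}) :
  eq_upto N p q -> eq_upto N (p * r) (q * r).
Proof.
move=> eq_pq i le_iN; rewrite !coefM; apply: eq_bigr => j _.
by rewrite eq_pq // (leq_trans _ le_iN) // -ltnS.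
Qed.

Lemma XderivM (R : comNzRingType) (p q : {poly R}) :
  'X * (p * q)^`() = 'X * p^`() * q + 'X * q^`() * p.
Proof. by rewrite derivM mulrDr !mulrA [X in _ + X]mulrAC. Qed.

Lemma coef_Xderiv (R : nzRingType) (p : {poly R}) i :
  ('X * p^`())`_i = p`_i *+ i.
Proof. by rewrite coefXM coef_deriv; case: i. Qed.

(* G m stands for the logarithmic derivative X (F m)' / F m. *)
Lemma log_deriv_prod_upto (R : comNzRingType) N (I : eqType) (s : seq I)
    (F G : I -> {poly R}) :
  (forall m, m \in s -> eq_upto N ('X * (F m)^`()) (G m * F m)) ->
  eq_upto N ('X * (\prod_(m <- s) F m)^`())
            ((\sum_(m <- s) G m) * \prod_(m <- s) F m).
Proof.
elim: s => [|m s IHs] FG i le_iN.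
  by rewrite !big_nil derivC mulr0 mul0r.
rewrite !big_cons XderivM mulrDl mulrA [_ * (F m * _)]mulrCA.
rewrite [F m * (_ * _)]mulrC !coefD; congr (_ + _).
  exact: (eq_upto_mulr _ (FG _ (mem_head _ _))).
apply: (eq_upto_mulr _ _ le_iN); apply: IHs => k s_k.
by apply: FG; rewrite inE s_k orbT.
Qed.

(* The coefficients of m X^m / (1 - X^m) up to degree N. *)
Definition lambert (R : nzRingType) (N m : nat) : {poly R} :=
  \poly_(i < N.+1) (if (0 < i)%N && (m %| i)%N then m%:R else 0).

(** Coefficients i and i - m cancel for i > m, as m divides both or neither. At i = m the subtracted
    constant term is 0, thanks to the guard [0 < i] in [lambert]. *)
Lemma lambert_mul_1subXn (R : nzRingType) N m : (0 < m)%N ->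
  eq_upto N (lambert R N m * (1 - 'X^m)) ('X^m *+ m).
Proof.
move=> m_gt0 i le_iN; rewrite mulrBr mulr1 coefB coefMXn coefMn coefXn.
rewrite !coef_poly ltnS le_iN ltnS (leq_trans (leq_subr _ _) le_iN).
case: (ltngtP i m) => [lt_im | lt_mi | ->] /=.
- case: (posnP i) => [-> | i_gt0] /=; first by rewrite subr0 mul0rn.
  by rewrite gtnNdvd // subr0 mul0rn.
- rewrite subn_gt0 lt_mi /=.
  rewrite dvdn_subl ?(ltnW lt_mi) // mul0rn (leq_ltn_trans _ lt_mi) //=.
  by rewrite subrr.
- by rewrite subnn dvdnn m_gt0 subr0.
Qed.

(** By the chain rule both sides are multiples of - (k + 1) (1 - X^m)^k, and the cofactors are the
    two sides of [lambert_mul_1subXn]. *)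
Lemma Xderiv_1subXn_exp (R : comNzRingType) N m k : (0 < m)%N ->
  eq_upto N ('X * ((1 - 'X^m) ^+ k.+1 : {poly R})^`())
            (- (lambert R N m *+ k.+1) * (1 - 'X^m) ^+ k.+1).
Proof.
move=> m_gt0 i le_iN.
have ->: 'X * ((1 - 'X^m) ^+ k.+1 : {poly R})^`()
    = ('X^m *+ m) * (- (1 - 'X^m) ^+ k *+ k.+1).
  case: m m_gt0 => // m _.
  rewrite deriv_exp derivB derivXn derivC sub0r /=.
  rewrite [in X in _ = X *+ _ * _]exprS.
  by rewrite !(mulNr, mulrN, mulrnAl, mulrnAr, mulNrn) !mulrA mulrnAC.
have ->: - (lambert R N m *+ k.+1) * (1 - 'X^m) ^+ k.+1
    = (lambert R N m * (1 - 'X^m)) * (- (1 - 'X^m) ^+ k *+ k.+1).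
  by rewrite exprS !(mulNr, mulrN, mulrnAl, mulrnAr, mulNrn) !mulrA.
by symmetry; apply: (eq_upto_mulr _ (lambert_mul_1subXn _ m_gt0)).
Qed.

Lemma sum_coef_lambert (R : nzRingType) N i : (0 < i <= N)%N ->
  (\sum_(1 <= m < N.+1) lambert R N m)`_i = (sigma i)%:R.
Proof.
case/andP=> i_gt0 le_iN; rewrite coef_sum.
under eq_bigr do rewrite coef_poly ltnS le_iN i_gt0 /=.
rewrite -big_mkcond /= /sigma natr_sum -big_filter.
apply: perm_big; apply: uniq_perm.
- by rewrite filter_uniq ?iota_uniq.
- exact: divisors_uniq.
move=> d; rewrite mem_filter mem_index_iota -dvdn_divisors // ltnS.
case: (boolP (d %| i)%N) => //= d_i.
by rewrite (dvdn_gt0 i_gt0 d_i) (leq_trans (dvdn_leq i_gt0 d_i)).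
Qed.

Lemma tau_newton :
  newton_rec (fun k => - 24 * (sigma k)%:Z) (fun n => tau n.+1).
Proof.
move=> n; pose P : {poly int} := \prod_(1 <= m < n.+2) (1 - 'X^m) ^+ 24.
(* The factor X in the definition of [tau] shifts degrees by one. *)
have tauE i : (i <= n)%N -> tau i.+1 = P`_i.
  by move=> le_in; rewrite -(@tau_trunc i.+1 n.+1) // coefXM.
have /(_ n (leqnSn n)) : eq_upto n.+1 ('X * P^`())
    ((\sum_(1 <= m < n.+2) - (lambert int n.+1 m *+ 24)) * P).
  apply: log_deriv_prod_upto => m; rewrite mem_index_iota => /andP[m_gt0 _].
  exact: Xderiv_1subXn_exp.
rewrite tauE // mulr_natl -coef_Xderiv => ->.
(* The first term of the convolution vanishes because [lambert] has no constant term; the sum then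
   starts at S_1. *)
rewrite sumrN sumrMnl coefM big_ord_recl.
rewrite coefN coefMn coef_sum big1 => [|m _]; last by rewrite coef_poly.
rewrite mul0rn oppr0 mul0r add0r.
apply: eq_bigr => k _; rewrite lift0 coefN coefMn sum_coef_lambert; last first.
  exact: leqW (ltn_ord k).
by rewrite tauE ?leq_subr // mulNr mulr_natl natz.
Qed.

(** * Determinants of Hessenberg matrices *)

(* Replacing the first column of A by A v does not change the determinant and
   leaves c in the bottom left corner as its only non-zero entry. *)
Lemma det_Hessenberg (R : comNzRingType) n (A : 'M[R]_n.+1) (v : 'cV[R]_n.+1)
    (c : R) :
  (forall i k : 'I_n.+1, (i.+1 < k)%N -> A i k = 0) ->
  v 0 0 = 1 -> A *m v = c *: delta_mx ord_max 0 ->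
  \det A = (-1) ^+ n * c * \prod_(i < n) A (widen_ord (leqnSn n) i) (lift 0 i).
Proof.
move=> A0 v0 Av.
pose M : 'M[R]_n.+1 := \matrix_(i, k) if k == 0 then v i 0 else (i == k)%:R.
have detM : \det M = 1.
  rewrite det_trig; last first.
    apply/is_trig_mxP=> i k lt_ik; rewrite mxE -val_eqE /=.
    rewrite (gtn_eqF (leq_ltn_trans _ lt_ik)) //.
    by rewrite -val_eqE /= ltn_eqF.
  apply: big1 => i _; rewrite mxE eqxx; case: eqP => // ->; exact: v0.
have AM i k : (A *m M) i k = if k == 0 then c *+ (i == ord_max) else A i k.
  rewrite mxE; case: ifPn => [k0 | k_n0].
    have := congr1 (fun B : 'cV_n.+1 => B i 0) Av.
    rewrite !mxE eqxx andbT mulr_natr => <-.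
    by apply: eq_bigr => j _; rewrite mxE k0.
  rewrite (bigD1 k) //= big1 => [|j /negPf jk].
    by rewrite mxE (negPf k_n0) eqxx mulr1 addr0.
  by rewrite mxE (negPf k_n0) jk mulr0.
have ->: \det A = \det (A *m M) by rewrite det_mulmx detM mulr1.
rewrite (expand_det_col _ 0) (bigD1 ord_max) //=.
rewrite big1 => [|i /negPf i_max]; last by rewrite AM eqxx i_max mul0r.
rewrite AM !eqxx addr0 /cofactor addn0 mulrCA mulrA; congr (_ * _).
(* Without its last row and first column the matrix is lower triangular, with the superdiagonal of
   [A] on its diagonal. *)
rewrite det_trig; last first.
  apply/is_trig_mxP=> i k lt_ik; rewrite 2!mxE AM /=; apply: A0.
  by rewrite lift_max lift0 ltnS.
apply: eq_bigr => i _; rewrite 2!mxE AM /=; congr (A _ _).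
by apply: val_inj; rewrite [LHS]lift_max.
Qed.

(** The vector is (h_0, ..., h_n). In every row but the last, the superdiagonal entry cancels the
    recurrence sum; the last row has no such entry and leaves (n + 1) h_(n+1). *)
Lemma det_Jmx (R : comNzRingType) (p h : nat -> R) n :
  h 0%N = 1 -> newton_rec p h -> \det (Jmx n p) = (n`!)%:R * h n.
Proof.
move=> h0 rec; case: n => [|n]; first by rewrite det_mx00 h0 mulr1.
have rec_rev i : \sum_(k < i.+1) p (i - k).+1 * h k = i.+1%:R * h i.+1.
  rewrite rec (reindex_inj rev_ord_inj) /=; apply: eq_bigr => k _.
  by rewrite subSS subKn // -ltnS.
rewrite (@det_Hessenberg _ _ _ (\col_i h i) (n.+1%:R * h n.+1)).
(* The n signs of the superdiagonal cancel the sign (-1)^n of the cofactor. *)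
- under eq_bigr => i _.
    rewrite mxE lift0 ltnn eqxx -mulN1r. over.
  rewrite big_split /= prodr_const card_ord mulrACA -expr2 sqrr_sign mul1r.
  by rewrite mulrAC -natr_prod -natrM factS fact_prod big_add1 big_mkord.
- move=> i k lt_ik; rewrite mxE leqNgt (ltnW lt_ik) /=.
  by rewrite gtn_eqF.
- by rewrite mxE h0.
apply/matrixP=> i j; rewrite !mxE ord1 eqxx andbT mulr_natr.
case: (eqVneq i ord_max) => [-> | i_max].
  rewrite -rec_rev; apply: eq_bigr => k _.
  by rewrite !mxE -ltnS ltn_ord.
have lt_in : (i.+1 < n.+1)%N by rewrite ltnS ltn_neqAle [_ != n]i_max -ltnS /=.
rewrite (bigD1 (Ordinal lt_in)) //= !mxE ltnn eqxx mulNr /= -(rec_rev i).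
rewrite (big_ord_widen n.+1 (fun k => p (i - k).+1 * h k)) 1?ltnW //.
rewrite -sumrN [X in X + _]big_mkcond [X in _ + X]big_mkcond -big_split /=.
apply: big1 => k _; rewrite !mxE -val_eqE /= ltnS.
case: leqP => [le_ki | lt_ik]; first by rewrite ltn_eqF //= addNr.
by rewrite add0r; case: eqP => //=; rewrite mul0r.
Qed.

(** The vector is (1, - p_1, ..., - p_n), so each row is the difference of the two sides of the
    recurrence, except that the last row lacks its final term. *)
Lemma det_Hmx (R : comNzRingType) (p h : nat -> R) n :
  h 0%N = 1 -> newton_rec p h -> \det (Hmx n.+1 h) = (-1) ^+ n * p n.+1.
Proof.
move=> h0 rec; pose v : 'cV[R]_n.+1 := \col_i if i == 0 then 1 else - p i.
rewrite (@det_Hessenberg _ _ _ v (p n.+1)).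
- rewrite big1 ?mulr1 // => i _; rewrite mxE /=.
  by rewrite /bump /= add1n ltnn eqxx.
- move=> i k lt_ik; rewrite mxE (gtn_eqF (leq_trans _ lt_ik)) // leqNgt.
  by rewrite (ltnW lt_ik) /= gtn_eqF.
- by rewrite mxE eqxx.
apply/matrixP=> i j; rewrite !mxE ord1 eqxx andbT mulr_natr.
rewrite big_ord_recl !mxE eqxx mulr1 rec.
have Hv k : Hmx n.+1 h i (lift 0 k) * v (lift 0 k) 0
    = - (if (k < i.+1)%N then p k.+1 * h (i - k)%N else 0).
  rewrite !mxE /= /bump /= add1n mulrN mulrC ltnS; congr (- _).
  rewrite eqSS; case: ltngtP => [lt_ki | _ | ->]; rewrite ?mulr0 //.
    by rewrite subnSK.
  by rewrite subnn h0.
under [X in _ + X]eq_bigr do rewrite Hv.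
rewrite sumrN; under eq_bigr do rewrite subSS.
case: (eqVneq i ord_max) => [-> | i_max].
  (* The missing term is p_(n+1) h_0, which is what remains. *)
  rewrite big_ord_recr subnn h0 mulr1 /= addrAC.
  under [X in _ - X]eq_bigr do rewrite ltnS ltnW //.
  by rewrite subrr add0r.
have le_in : (i.+1 <= n)%N by rewrite ltn_neqAle [_ != n]i_max -ltnS /=.
rewrite (big_ord_widen n (fun k => p k.+1 * h (i - k)%N)) //.
by rewrite big_mkcond subrr.
Qed.

(** * The sum over partitions *)

Lemma zpart_trunc l N : (sumn l <= N)%N ->
  zpart l = (\prod_(1 <= k < N.+1) (k ^ count_mem k l * (count_mem k l)`!))%N.
Proof.
move=> le_lN; rewrite /zpart [RHS](@big_cat_nat _ _ _ (sumn l).+1) //=.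
rewrite [X in (_ * X)%N]big_nat_cond [X in (_ * X)%N]big1 ?muln1 // => k.
rewrite andbT => /andP[lt_lk _].
rewrite (count_memPn _) //; apply: contraL lt_lk => /mem_leq_sumn.
by rewrite -leqNgt.
Qed.

Lemma zpart_perm l1 l2 : perm_eq l1 l2 -> zpart l1 = zpart l2.
Proof.
move=> eq_l; rewrite /zpart (perm_sumn eq_l); apply: eq_bigr => k _.
by rewrite (permP eq_l).
Qed.

(** Over a common range of products only the factor at k changes, from k^m m! to k^(m+1) (m+1)!. *)
Lemma zpart_cons k l : (0 < k)%N ->
  zpart (k :: l) = (k * (count_mem k l).+1 * zpart l)%N.
Proof.
move=> k_gt0; rewrite (@zpart_trunc l (k + sumn l)) ?leq_addl // /zpart /=.
have k_in : k \in index_iota 1 (k + sumn l).+1.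
  by rewrite mem_index_iota k_gt0 ltnS leq_addr.
rewrite !(bigD1_seq k k_in) ?iota_uniq //= eqxx add1n expnS factS.
rewrite mulnACA -mulnA; congr (_ * (_ * _))%N.
by apply: eq_bigr => j /negPf jk; rewrite eq_sym jk.
Qed.

Lemma sumn_count_mem l N : (sumn l <= N)%N ->
  sumn l = (\sum_(k < N) k.+1 * count_mem k.+1 l)%N.
Proof.
elim: l => [|x l IHl] /= le_lN; first by rewrite big1 // => k _; rewrite muln0.
under eq_bigr do rewrite mulnDr.
rewrite big_split /= -IHl; last exact: leq_trans (leq_addl _ _) le_lN.
congr (_ + _)%N; case: x le_lN => [|x] le_lN.
  by rewrite big1 // => k; rewrite muln0.
have lt_xN : (x < N)%N by apply: leq_trans (leq_addr _ _) le_lN.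
rewrite (bigD1 (Ordinal lt_xN)) //= eqxx muln1 big1 ?addn0 // => k.
by rewrite -val_eqE eq_sym eqSS /= => /negPf->; rewrite muln0.
Qed.

Section Weight.
Variables (F : numFieldType) (p : nat -> F).

Definition weight (l : seq nat) : F := (zpart l)%:R^-1 * spart p l.

Lemma weight_perm l1 l2 : perm_eq l1 l2 -> weight l1 = weight l2.
Proof.
by move=> eq_l; rewrite /weight (zpart_perm eq_l) /spart (perm_big _ eq_l).
Qed.

Lemma weight_rem k l : (0 < k)%N -> k \in l ->
  (k * count_mem k l)%:R * weight l = p k * weight (rem k l).
Proof.
move=> k_gt0 k_l; have eq_l := perm_to_rem k_l.
rewrite (permP eq_l) (weight_perm eq_l) /weight zpart_cons //= eqxx add1n.
rewrite /spart big_cons [(_ * zpart _)%:R]natrM invfM !mulrA mulfV; last first.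
  by rewrite pnatr_eq0 -lt0n muln_gt0 k_gt0.
by rewrite mul1r [_ * p k]mulrC.
Qed.

Lemma is_partition_add n k l : (0 < k <= n)%N -> is_partition_of (n - k) l ->
  is_partition_of n (sort geq (k :: l)).
Proof.
case/andP=> k_gt0 le_kn /and3P[_ l_gt0 /eqP l_sum]; apply/and3P; split.
- by apply: sort_sorted => x y; exact: leq_total.
- by rewrite mem_sort inE negb_or l_gt0 andbT eq_sym -lt0n.
- by rewrite (perm_sumn (permEl (perm_sort _ _))) /= l_sum subnKC.
Qed.

Lemma is_partition_rem n k l : k \in l -> is_partition_of n l ->
  is_partition_of (n - k) (rem k l).
Proof.
move=> k_l /and3P[l_sort l_gt0 /eqP l_sum]; apply/and3P; split.
- apply: subseq_sorted (rem_subseq _ _) l_sort.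
  by move=> x y z yx xz; apply: leq_trans xz yx.
- by apply: contra l_gt0 => /mem_rem.
- by rewrite -l_sum (perm_sumn (perm_to_rem k_l)) /= addKn.
Qed.

Lemma sort_rem_geq k l : sorted geq l -> k \in l ->
  sort geq (k :: rem k l) = l.
Proof.
move=> l_sort k_l; apply: (sorted_eq _ _ (sort_sorted _ _) l_sort).
- by move=> x y z yx xz; apply: leq_trans xz yx.
- by move=> x y; rewrite andbC => /anti_leq.
- by move=> x y; exact: leq_total.
by rewrite perm_sort perm_sym perm_to_rem.
Qed.

Lemma rem_sort_geq k l : sorted geq l -> rem k (sort geq (k :: l)) = l.
Proof.
move=> l_sort; have k_s : k \in sort geq (k :: l) by rewrite mem_sort mem_head.
apply: (@sorted_eq _ geq) l_sort _.
- by move=> x y z yx xz; apply: leq_trans xz yx.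
- by move=> x y; rewrite andbC => /anti_leq.
- apply: subseq_sorted (rem_subseq _ _) (sort_sorted _ _).
    by move=> x y z yx xz; apply: leq_trans xz yx.
  by move=> x y; exact: leq_total.
by rewrite -(perm_cons k) -(permPl (perm_to_rem k_s)) perm_sort.
Qed.

(** Inserting k and sorting is a bijection onto the partitions that contain k. Its inverse [del] is
    partial, since removing k lowers the sum by k only if k is a part. *)
Lemma sum_partition_rem n k (f : seq nat -> F) : (0 < k <= n)%N ->
  \sum_(l : partition_of n | k \in parts l) f (rem k l) =
  \sum_(l : partition_of (n - k)) f l.
Proof.
move=> k_n.
pose add (l : partition_of (n - k)) : partition_of n :=
  PartitionOf (is_partition_add k_n (partsP l)).
pose del (l : partition_of n) : option (partition_of (n - k)) :=
  insub (rem k l).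
rewrite (reindex_omap add del) => [|l k_l]; last first.
  rewrite /del insubT; first exact: is_partition_rem k_l (partsP l).
  move=> remP /=; congr Some; apply: val_inj => /=.
  by rewrite sort_rem_geq //; case/and3P: (partsP l).
have sortP (l : partition_of (n - k)) : sorted geq l by case/and3P: (partsP l).
apply: eq_big => [l | l _] /=; last by rewrite rem_sort_geq.
by rewrite mem_sort mem_head /del /= rem_sort_geq // valK eqxx.
Qed.

(** Write n as the sum of k m_k(l) for each l, exchange the sums, and apply [weight_rem] to each
    term. *)
Lemma sum_weight_newton :
  newton_rec p (fun n => \sum_(l : partition_of n) weight l).
Proof.
move=> n; rewrite big_distrr /=.
transitivity (\sum_(l : partition_of n) \sum_(k < n)
   (k.+1 * count_mem k.+1 l)%:R * weight l).
  apply: eq_bigr => l _; rewrite -big_distrl -natr_sum /=; congr (_%:R * _).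
  have /and3P[_ _ /eqP l_sum] := partsP l.
  by rewrite -[LHS]l_sum; apply: sumn_count_mem; rewrite l_sum.
rewrite exchange_big /=; apply: eq_bigr => k _.
rewrite -(@sum_partition_rem n k.+1 weight) ?ltn_ord // big_distrr /=.
(* Partitions without the part k + 1 have multiplicity 0 and contribute nothing. *)
rewrite (bigID (fun l : partition_of n => k.+1 \in parts l)) /=.
rewrite [X in _ + X]big1 ?addr0 => [|l /count_memPn->]; last first.
  by rewrite muln0 mul0r.
by apply: eq_bigr => l k_l; apply: weight_rem.
Qed.

Lemma sum_weight0 : \sum_(l : partition_of 0) weight l = 1.
Proof.
pose l0 : partition_of 0 := @PartitionOf 0 [::] isT.
have l_nil (l : partition_of 0) : l = l0.
  apply: val_inj; case/and3P: (partsP l) => _ l_gt0 /eqP l_sum.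
  by apply/nilP; rewrite /nilp -leqn0 (leq_trans (size_leq_sumn l_gt0)) ?l_sum.
rewrite (bigD1 l0) //= big1 ?addr0 => [|l /eqP[]]; last exact: l_nil.
by rewrite /weight /spart /zpart /= big_geq // big_nil invr1 mulr1.
Qed.

End Weight.

(** * Uniqueness of the solution, and conclusion *)

(** The right-hand side at n + 1 involves only h_0, ..., h_n, and n + 1 is invertible in
    characteristic 0. *)
Lemma newton_rec_unique (F : numFieldType) (p h1 h2 : nat -> F) :
  h1 0%N = h2 0%N -> newton_rec p h1 -> newton_rec p h2 -> h1 =1 h2.
Proof.
move=> h0 rec1 rec2; elim/ltn_ind=> -[|n] // IHn.
have n_neq0 : n.+1%:R != 0 :> F by rewrite pnatr_eq0.
apply: (mulfI n_neq0); rewrite rec1 rec2; apply: eq_bigr => k _.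
by rewrite IHn // subSS ltnS leq_subr.
Qed.

Theorem theorem3p1 :
  let T : nat -> int := fun n => tau n.+1 in
  let S : nat -> int := fun k => - 24 * (sigma k)%:Z in
  forall n : nat, (1 <= n)%N ->
  [/\ (n`!)%:Z * T n = \det (Jmx n S),
      S n = (-1) ^+ (n - 1) * \det (Hmx n T),
      - 24 * (sigma n)%:Z = (-1) ^+ (n - 1) * \det (Hmx n T)
    & (T n)%:~R =
        \sum_(l : partition_of n) ((zpart l)%:R)^-1 * (spart S l)%:~R :> rat].
Proof.
move=> T S [//|n] _.
have SE : S n.+1 = (-1) ^+ (n.+1 - 1) * \det (Hmx n.+1 T).
  by rewrite (det_Hmx _ tau1 tau_newton) subn1 mulrA -expr2 sqrr_sign mul1r.
split=> //; first by rewrite (det_Jmx _ tau1 tau_newton) natz.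
(* The inverses of z force the last identity into the rationals, so the integer recurrence is
   transported there. *)
pose p k : rat := (S k)%:~R; pose h k : rat := (T k)%:~R.
have h_rec : newton_rec p h.
  move=> k; have /= := congr1 (intr : int -> rat) (tau_newton k).
  rewrite rmorphM rmorph_nat rmorph_sum => ->.
  by apply: eq_bigr => i _; rewrite rmorphM.
have h0 : h 0%N = \sum_(l : partition_of 0) weight p l.
  by rewrite sum_weight0 /h /T tau1.
rewrite -/(h _) (newton_rec_unique h0 h_rec (sum_weight_newton p)) /=.
by apply: eq_bigr => l _; rewrite /weight /spart [in RHS](rmorph_prod intr).
Qed.
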